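(* Let $P(s)$ and $Q(s)$ be polynomials, let $R(s,r):=rP(s)-Q(s)^r$, and let $r=r(s)$ be the implicit function defined by $R(s,r(s))=0$ (where, if for a given $s$ there are two solutions $r$, the larger one is taken). Then the implicit function $r(s)$ has finitely many local maxima-minima.
   Context: For a fixed $s$, the solutions $r$ of $R(s,r)=0$ are given by the intersections of the straight line $y=P(s)x$ and the exponential curve $y=Q(s)^x$ in the $(x,y)$-plane. Three cases are distinguished: they intersect at two different points, giving two solutions $r_1(s)$ and $r_2(s)$; the line is tangent to the exponential curve, giving exactly one solution $r_0(s)$; or they do not intersect, and there is no solution. The implicit function is defined by $r(s)=\max\{r_1(s),r_2(s)\}$ in the first case and $r(s)=r_0(s)$ in the second case, and it is not defined in the third case. No assumption is made on the coefficients of the polynomials $P(s)$ and $Q(s)$.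
   Formalization: An interval on which r(s) is constant counts as one local extremum, since otherwise the claim fails for non-strict extrema (e.g. P(s) = Q(s) = s gives r(s) = 1 for all s ≥ e); r(s) is taken wherever Q(s) > 0 and a solution exists, including a single transversal intersection. *)

(* Defs.v *)
From HB Require Import structures.
From mathcomp Require Import all_boot all_order all_algebra.
From mathcomp Require Import all_classical all_reals all_analysis.
Set Implicit Arguments.
Unset Strict Implicit.
Unset Printing Implicit Defensive.
Import Order.TTheory GRing.Theory Num.Theory.
Import numFieldNormedType.Exports.
Local Open Scope classical_set_scope.
Local Open Scope ring_scope.

Definition Rfun (R : realType) (P Q : {poly R}) (s r : R) : R :=
  r * P.[s] - Q.[s] `^ r.

(* [powR] takes junk values at negative bases, and y = Q(s)^x is an exponential
   curve only for Q(s) > 0, so there is no solution when Q(s) <= 0. *)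
Definition solutions (R : realType) (P Q : {poly R}) (s : R) : set R :=
  [set r | 0 < Q.[s] /\ Rfun P Q s r = 0].

Definition implicit_dom (R : realType) (P Q : {poly R}) : set R :=
  [set s | solutions P Q s !=set0].

(* The largest solution; the default value 0 is irrelevant, since it is only
   taken outside [implicit_dom]: there are at most two solutions. *)
Definition implicit_fun (R : realType) (P Q : {poly R}) (s : R) : R :=
  xget 0 (solutions P Q s `&` ubound (solutions P Q s)).

(* Extrema are not required to be strict, and are relative to the domain D,
   so that endpoints and isolated points of D are allowed. *)
Definition local_max (R : realType) (D : set R) (f : R -> R) (s : R) : Prop :=
  D s /\ \forall t \near s, D t -> f t <= f s.

Definition local_min (R : realType) (D : set R) (f : R -> R) (s : R) : Prop :=
  D s /\ \forall t \near s, D t -> f s <= f t.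

Definition local_extremum (R : realType) (D : set R) (f : R -> R) (s : R) :
  Prop := local_max D f s \/ local_min D f s.

(* The largest interval around s on which f is defined and constant. *)
Definition plateau (R : realType) (D : set R) (f : R -> R) (s : R) : set R :=
  [set t | forall u, Num.min s t <= u <= Num.max s t -> D u /\ f u = f s].

(* A whole interval on which f is constant counts as one local extremum: for
   P = Q = 'X, say, r(s) = 1 for all s >= e, and every such s is a local
   extremum. When f is not constant on any nontrivial interval, plateaus
   are singletons, and this says that the set of local extrema is finite. *)
Definition finitely_many_local_extrema (R : realType) (D : set R)
    (f : R -> R) : Prop :=
  finite_set [set plateau D f s | s in [set s | local_extremum D f s]].

(* Main.v *)
Require Import Defs.
From mathcomp Require Import all_boot all_order all_algebra.
From mathcomp Require Import all_classical all_reals all_analysis.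
From mathcomp Require Import ring lra.

(* For p = P(s) and l = ln Q(s), the solutions r are the zeros of the concave
   function r p - exp(r l); a zero r is the largest one iff 1/r <= l, except
   when l <= 0 < p, where the zero is unique. If s0 is a local extremum where
   the line is not tangent, then r0 = r(s0) makes s |-> r0 P(s) - exp(r0 l(s))
   extremal at s0, so r0 = h(s0) with h = P'Q / (PQ') rational (unless Q is
   constant). Put G = ln(hP) - h l; then G' = h' (1/h - l). By Rolle, a function
   whose derivative has finitely many sign changes has itself finitely many
   sign changes; applied to 1/h - l (rational derivative) and then to G, it
   shows that, off a finite set, G = 0 at s0 forces G = 0 and h' = 0 on a whole
   interval around s0, on which therefore r = h is constant. *)

Set Implicit Arguments.
Unset Strict Implicit.
Unset Printing Implicit Defensive.
Import Order.TTheory GRing.Theory Num.Theory.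
Import numFieldNormedType.Exports.
Local Open Scope classical_set_scope.
Local Open Scope ring_scope.

(** * Cells cut out of the real line by finitely many points *)

Section Cells.
Variable R : realType.
Implicit Types (F G : seq R) (s t u : R) (A B : set R) (f g : R -> R).

(** Only comparisons with the points of [F] matter, so [F] may be unsorted and have repetitions; its
    own points belong to no cell. *)
Definition same_cell F s t : bool :=
  [&& s \notin F, t \notin F & all (fun x => (x < s) == (x < t)) F].

Lemma same_cellP F s t : reflect
  [/\ s \notin F, t \notin F & {in F, forall x, (x < s) = (x < t)}]
  (same_cell F s t).
Proof.
apply: (iffP and3P) => -[sF tF H]; split=> //.
  by move=> x xF; apply/eqP; exact: (allP H).
by apply/allP => x xF; rewrite H.
Qed.

Lemma same_cell_cat F G s t :
  same_cell (F ++ G) s t = same_cell F s t && same_cell G s t.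
Proof.
rewrite /same_cell !mem_cat all_cat !negb_or.
by rewrite -!andbA; do !bool_congr.
Qed.

Lemma same_cell_sym F s t : same_cell F s t = same_cell F t s.
Proof.
by rewrite /same_cell andbCA; under eq_all do rewrite eq_sym.
Qed.

Lemma same_cell_trans F s t u :
  same_cell F s t -> same_cell F t u -> same_cell F s u.
Proof.
move=> /same_cellP[sF _ H] /same_cellP[_ uF K]; apply/same_cellP; split=> //.
by move=> x xF; rewrite H ?K.
Qed.

Lemma same_cell_refl F s : s \notin F -> same_cell F s s.
Proof. by move=> sF; apply/same_cellP. Qed.

Lemma same_cell_between F s t u :
  same_cell F s t -> s <= u <= t -> same_cell F s u.
Proof.
move=> /same_cellP[sF tF H] /andP[su ut]; apply/same_cellP; split=> //.
  apply/negP => uF; have := H _ uF.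
  rewrite ltNge su /= lt_neqAle ut andbT => /esym /negbFE/eqP ute.
  by rewrite -ute uF in tF.
move=> x /H; have [xs _|sx /esym tx] := ltP x s.
  by rewrite (lt_le_trans xs su).
by apply/esym/negbTE; rewrite -leNgt (le_trans ut)// leNgt tx.
Qed.

Lemma same_cell_near F s : s \notin F -> \forall t \near s, same_cell F s t.
Proof.
elim: F => [_|x F IH]; first by near=> t.
rewrite inE negb_or => /andP[sx /IH{}IH].
rewrite -[x :: F]/([:: x] ++ F).
have [xs|sx'] : x < s \/ s < x by apply/orP; rewrite orbC -neq_lt.
  near=> t; rewrite same_cell_cat; apply/andP; split; last by near: t.
  have xt : x < t by near: t; apply: lt_nbhsr.
  apply/same_cellP; rewrite !inE sx; split=> //; first by rewrite gt_eqF.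
  by move=> y /[!inE] /eqP ->; rewrite xs xt.
near=> t; rewrite same_cell_cat; apply/andP; split; last by near: t.
have tx : t < x by near: t; apply: lt_nbhsl.
apply/same_cellP; rewrite !inE sx; split=> //; first by rewrite lt_eqF.
by move=> y /[!inE] /eqP ->; rewrite !ltNge !ltW.
Unshelve. all: by end_near. Qed.

(** A label in a finite type, so that choosing one point per cell gives a finite set. *)
Definition cell_index F s : (size F).-tuple bool :=
  map_tuple (fun x => x < s) (in_tuple F).

Lemma cell_indexP F s t : s \notin F -> t \notin F ->
  (cell_index F s == cell_index F t) = same_cell F s t.
Proof.
move=> sF tF; apply/eqP/same_cellP => [|[_ _ H]].
  by move=> /(congr1 val)/= /eq_in_map H; split.
by apply/val_inj/eq_in_map.
Qed.

(** * Tameness: finitely many changes of membership or sign *)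

Definition tame_set A : Prop :=
  exists F, forall s t, same_cell F s t -> A s -> A t.

Definition tame A f : Prop :=
  exists F, forall s t, same_cell F s t -> A s -> A t ->
    Num.sg (f s) = Num.sg (f t).

Lemma tame_setI A B : tame_set A -> tame_set B -> tame_set (A `&` B).
Proof.
move=> [F HF] [G HG]; exists (F ++ G) => s t.
by rewrite same_cell_cat => /andP[/HF + /HG +] [As Bs]; split; auto.
Qed.

Lemma tame_subset A B f : A `<=` B -> tame B f -> tame A f.
Proof. by move=> AB [F HF]; exists F => s t st /AB As /AB At; exact: HF.
Qed.

Lemma eq_tame A f g : (forall s, A s -> f s = g s) -> tame A f -> tame A g.
Proof. by move=> fg [F HF]; exists F => s t st As At; rewrite -!fg// (HF s t).
Qed.

Lemma tameM A f g : tame A f -> tame A g -> tame A (fun s => f s * g s).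
Proof.
move=> [F HF] [G HG]; exists (F ++ G) => s t.
by rewrite same_cell_cat !sgrM => /andP[/HF + /HG +] As At => -> // -> //.
Qed.

Lemma tameV A f : tame A f -> tame A (fun s => (f s)^-1).
Proof. by move=> [F HF]; exists F => s t st As At; rewrite !sgrV (HF s t). Qed.

Lemma tame_gt0 f : tame setT f -> tame_set [set s | 0 < f s].
Proof.
move=> [F HF]; exists F => s t st /=.
by rewrite -[0 < f s]sgr_gt0 -[0 < f t]sgr_gt0 (HF s t).
Qed.

Lemma tame_cst A (c : R) : tame A (fun=> c).
Proof. by exists [::]. Qed.

(** On a cell where [df] has constant sign, two zeros of [f] force a zero of [df], hence [df = 0]
    and [f] is constant there. Otherwise the cell holds at most one zero, and cutting there fixes
    the sign of [f]. *)
Lemma tame_rolle A f (df : R -> R) : tame_set A ->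
  (forall s, A s -> is_derive s 1 f (df s)) -> tame A df -> tame A f.
Proof.
move=> [F1 HA] fd [F2 Hdf]; pose F := F1 ++ F2.
have AF s t : same_cell F s t -> A s -> A t.
  by rewrite same_cell_cat => /andP[/HA].
have dfF s t : same_cell F s t -> A s -> A t -> Num.sg (df s) = Num.sg (df t).
  by rewrite same_cell_cat => /andP[_ /Hdf].
(* One zero of [f] per cell; where there is none, the default 0 is a harmless extra cut point. *)
pose z v := xget 0 [set s | s \notin F /\ cell_index F s = v /\ f s = 0].
exists (F ++ [seq z v | v : (size F).-tuple bool]).
suff H s t : s <= t ->
    same_cell (F ++ [seq z v | v : (size F).-tuple bool]) s t ->
    A s -> Num.sg (f s) = Num.sg (f t).
  move=> s t st As At; have [le_st|/ltW le_ts] := leP s t; first exact: H.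
  by apply/esym/H => //; rewrite same_cell_sym.
move=> le_st; rewrite same_cell_cat => /andP[stF stZ] As.
have btw a b u : same_cell F s a -> same_cell F s b -> a <= u <= b ->
    same_cell F s u.
  move=> sa sb aub; apply: (same_cell_trans sa).
  apply: (same_cell_between _ aub).
  by apply: same_cell_trans sb; rewrite same_cell_sym.
have fc a b : same_cell F s a -> same_cell F s b ->
    {within `[a, b], continuous f}.
  move=> sa sb; apply: derivable_within_continuous => u.
  rewrite in_itv/= => uab.
  by have := fd _ (AF _ _ (btw _ _ _ sa sb uab) As); case.
have rolle a b : same_cell F s a -> same_cell F s b -> a < b -> f a = 0 ->
    f b = 0 -> Num.sg (f s) = Num.sg (f t).
  move=> sa sb ab fa fb.
  have [|c||c cab [_ dc]] := @Rolle R f a b ab.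
  - move=> u; rewrite in_itv/= => /andP[ua ub].
    by case: (fd u) => //; apply: AF As; apply: (btw _ _ _ sa sb); rewrite !ltW.
  - exact: fc.
  - by rewrite fa fb.
  have sc : same_cell F s c.
    move: cab; rewrite in_itv/= => /andP[??].
    by apply: (btw _ _ _ sa sb); rewrite !ltW.
  have dfc : df c = 0.
    by have [_ <-] := fd c (AF _ _ sc As).
  have df0 u : same_cell F s u -> df u = 0.
    move=> su; apply/eqP; rewrite -sgr_eq0 -(dfF c).
    - by rewrite dfc sgr0.
    - by apply: same_cell_trans su; rewrite same_cell_sym.
    - exact: AF As.
    - exact: AF As.
  have sF : same_cell F s s by apply: same_cell_refl; case/same_cellP: stF.
  move: le_st; rewrite le_eqVlt => /predU1P[->//|lt_st].
  have [||x xst] := @MVT R f df s t lt_st.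
  - move=> u; rewrite in_itv/= => /andP[ua ub]; apply: fd.
    by apply: AF As; apply: (btw _ _ _ sF stF); rewrite !ltW.
  - exact: fc.
  rewrite df0 ?mul0r; last first.
    move: xst; rewrite in_itv/= => /andP[??].
    by apply: (btw _ _ _ sF stF); rewrite !ltW.
  by move=> /eqP; rewrite subr_eq0 => /eqP ->.
have sF : same_cell F s s by apply: same_cell_refl; case/same_cellP: stF.
apply/eqP/negPn/negP => nst.
have [||c cst fc0] := @IVT R f s t 0 le_st.
- exact: fc.
- move: nst; rewrite ge_min le_max.
  by case: (sgrP (f s)); case: (sgrP (f t)); rewrite ?eqxx// => h1 h2 _;
    move: h1 h2 => *; apply/andP; split; apply/orP; lra.
move: cst; rewrite in_itv/= => scst.
have sc : same_cell F s c := btw _ _ _ sF stF scst.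
have [cF sFF] : c \notin F /\ s \notin F by case/same_cellP: sc.
pose v := cell_index F s.
have [zF [zv fz]] : z v \notin F /\ cell_index F (z v) = v /\ f (z v) = 0.
  apply: (@xgetPex _ 0 [set s | s \notin F /\ cell_index F s = v /\ f s = 0]).
  exists c; split=> //; split=> //; apply/eqP.
  by rewrite cell_indexP// same_cell_sym.
have sz : same_cell F s (z v) by rewrite -cell_indexP// zv.
(* The cut point [z v] cannot lie between [s] and [t], so [c] is a second zero in the cell. *)
have cz : c != z v.
  have /same_cellP[_ cZ _] := same_cell_between stZ scst.
  apply: contra cZ => /eqP ->; apply/mapP; exists v => //.
  by rewrite mem_enum.
move: cz; rewrite neq_lt => /orP[|] lt_cz; move/negP: nst; apply; apply/eqP.
  exact: (rolle c (z v)).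
exact: (rolle (z v) c).
Qed.

Lemma tame_poly A (p : {poly R}) : tame A (horner p).
Proof.
apply: (@tame_subset _ setT) => //.
have [n] := ubnP (size p); elim: n p => // n IH p; rewrite ltnS => pn.
have [p1|p1] := leqP (size p) 1.
  rewrite (size1_polyC p1); apply: eq_tame (tame_cst _ p`_0) => s _.
  by rewrite hornerC.
have sz : (size p^`() < n)%N.
  apply: leq_trans pn; apply: lt_size_deriv.
  by rewrite -size_poly_gt0 (ltn_trans _ p1).
by apply: tame_rolle (IH _ sz); exists [::].
Qed.

(** This form covers the zero polynomial without a case split. Linear factors are divided out one at
    a time. *)
Lemma finite_roots (p : {poly R}) :
  exists F, forall x, p.[x] = 0 -> x \notin F -> p = 0.
Proof.
have [n] := ubnP (size p); elim: n p => // n IH p; rewrite ltnS => pn.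
have [/existsNP[a /existsNP[pa p0]]|/contrapT H] :=
    pselect (~ forall x, p.[x] = 0 -> p = 0); last by exists [::] => x /H.
have [q pq] := factor_theorem p a (introT rootP pa).
have q0 : q != 0 by apply: contra_notN p0 => /eqP q0; rewrite pq q0 mul0r.
have [|F HF] := IH q.
  by apply: leq_trans pn; rewrite pq size_Mmonic ?monicXsubC// size_XsubC addn2.
exists (a :: F) => x px; rewrite inE negb_or => /andP[xa xF].
suff : q = 0 by move: q0 => /eqP.
apply: (HF x) => //; apply/eqP; move/eqP: px.
by rewrite pq !hornerE mulf_eq0 subr_eq0 (negbTE xa) orbF.
Qed.

Lemma near_max_derive0 f s d : (\forall t \near s, derivable f t 1) ->
  (\forall t \near s, f t <= f s) -> is_derive s 1 f d -> d = 0.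
Proof.
move=> fd fs fsd.
have : \forall t \near s, derivable f t 1 /\ f t <= f s.
  by near=> t; split; near: t.
move=> /nbhs_ballP[e /= e0 H].
have K t : t \in `]s - e, s + e[%R -> derivable f t 1 /\ f t <= f s.
  rewrite in_itv/= => ?; apply: H; rewrite /ball/= ltr_norml; apply/andP; lra.
have [] := @derive1_at_max R f (s - e) (s + e) s.
- by move: e0 => /=; lra.
- by move=> t /K[].
- by rewrite in_itv/= ltrBlDr ltrDl e0.
- by move=> t /K[].
by case: fsd => _ <-.
Unshelve. all: by end_near. Qed.

Lemma near_min_derive0 f s d : (\forall t \near s, derivable f t 1) ->
  (\forall t \near s, f s <= f t) -> is_derive s 1 f d -> d = 0.
Proof.
move=> fd fs fsd; apply: oppr_inj; rewrite oppr0.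
apply: (@near_max_derive0 (- f) s).
- by apply: filterS fd => t; exact: derivableN.
- by apply: filterS fs => t; rewrite !fctE lerN2.
Qed.

End Cells.

(** * Zeros of the gap between a line and an exponential curve *)

Section LineExponential.
Variable R : realType.
Implicit Types (p l r c : R).

Definition gap p l r : R := r * p - expR (r * l).

Lemma gap_ge0_gt0 p l r : 0 <= gap p l r -> 0 < r * p.
Proof. by rewrite subr_ge0; apply: lt_le_trans; exact: expR_gt0. Qed.

Lemma gap_incr p l c r : l <= 0 < p -> c < r -> gap p l c < gap p l r.
Proof.
move=> /andP[l0 p0] cr; apply: ltr_leB; first by rewrite ltr_pM2r.
by rewrite ler_expR ler_wnM2r// ltW.
Qed.

(* The gap is concave in r, and c^-1 <= l says that c lies past its maximum. *)
Lemma gap_lt0_after p l c r : 0 < c * p -> c^-1 <= l -> gap p l c <= 0 ->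
  c < r -> gap p l r < 0.
Proof.
move=> cp cl; rewrite /gap subr_le0 => gc cr; rewrite subr_lt0.
have [rp|rp] := leP (r * p) 0; first exact: le_lt_trans rp (expR_gt0 _).
have c0 : c != 0 by apply: contraTN cp => /eqP ->; rewrite mul0r ltxx.
(* With [t = (r - c) / c], the line is at [c p (1 + t) < c p exp t], and [c^-1 <= l] bounds [exp t]
   by [exp ((r - c) l)]. *)
have -> : r * p = c * p * (1 + (r - c) / c) by field.
have -> : r * l = c * l + (r - c) * l by ring.
rewrite expRD; apply: (@lt_le_trans _ _ (c * p * expR ((r - c) / c))).
  rewrite ltr_pM2l// expR_gt1Dx// mulf_neq0 ?invr_eq0//.
  by rewrite subr_eq0 gt_eqF.
apply: (ler_pM (ltW cp) (expR_ge0 _) gc).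
by rewrite ler_expR ler_pM2l ?subr_gt0.
Qed.

Lemma continuous_gap p l (i : interval R) :
  {within [set` i], continuous (gap p l)}.
Proof.
apply: derivable_within_continuous => x _; rewrite /gap.
by apply: ex_derive.
Qed.

(** To the right of [c] the gap becomes nonpositive: at 0 if [p < 0], otherwise because the
    exponential outgrows the line. *)
Lemma gap_root_ge p l c : p < 0 \/ 0 < l -> 0 <= gap p l c ->
  exists2 r, c <= r & gap p l r = 0.
Proof.
move=> pl gc; have cp := gap_ge0_gt0 gc.
suff [d cd gd] : exists2 d, c <= d & gap p l d <= 0.
  have [||r rcd gr] := @IVT R (gap p l) c d 0 cd.
  - exact: continuous_gap.
  - by rewrite ge_min le_max gc gd orbT.
  by exists r => //; move: rcd; rewrite in_itv/= => /andP[].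
have [p0|p0] := ltP p 0.
  exists 0; first by move: cp; rewrite nmulr_lgt0// => /ltW.
  by rewrite /gap !mul0r expR0 sub0r oppr_le0.
have l0 : 0 < l by case: pl => //; rewrite ltNge p0.
have {}p0 : 0 < p.
  by rewrite lt_neqAle p0 andbT; apply: contraTN cp => /eqP <-; rewrite mulr0 ltxx.
(* From [exp x >= x] at [x = d l / 2], [exp (d l) >= (d l)^2 / 4], which is at least [d p] once
   [d >= 4 p / l^2]. *)
pose d := c + 4 * p / l ^+ 2.
have c0 : 0 < c by rewrite -(pmulr_lgt0 _ p0).
have d0 : 0 < 4 * p / l ^+ 2 by rewrite divr_gt0 ?mulr_gt0 ?exprn_gt0.
exists d; first by rewrite lerDl ltW.
rewrite subr_le0.
have -> : d * l = d * l / 2 + d * l / 2 by field.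
rewrite expRD.
have dl : 0 <= d * l / 2 by rewrite divr_ge0// mulr_ge0 ?ltW// addr_gt0.
have H : d * l / 2 <= expR (d * l / 2) by have := expR_ge1Dx (d * l / 2); lra.
apply: le_trans (ler_pM dl dl H H).
have -> : d * l / 2 * (d * l / 2) = d * (d * l ^+ 2 / 4) by field.
rewrite ler_pM2l ?addr_gt0//.
rewrite ler_pdivlMr// -ler_pdivrMr ?exprn_gt0// [p * 4]mulrC /d; lra.
Qed.

(** At a zero, [exp (r l) = r p], so the slope of the gap is [r p (r^-1 - l)] with [r p > 0]; thus
    [r^-1 <= l] says that the gap is not increasing at [r]. *)
Definition last_root p l r : Prop :=
  gap p l r = 0 /\ (l <= 0 < p \/ r^-1 <= l).

Lemma last_root_max p l r r' : last_root p l r -> gap p l r' = 0 -> r' <= r.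
Proof.
move=> [gr C] gr'; rewrite leNgt; apply/negP => rr'.
case: C => [lp|rl].
  by have := gap_incr lp rr'; rewrite gr gr' ltxx.
have rp : 0 < r * p by apply: (@gap_ge0_gt0 _ l); rewrite gr.
have gr0 : gap p l r <= 0 by rewrite gr.
by have := gap_lt0_after rp rl gr0 rr'; rewrite gr' ltxx.
Qed.

(** Equality in the second hypothesis means tangency, at [r = l^-1]; for [l p <= 0] the inequality
    is automatic. *)
Lemma last_root_exists p l : p != 0 -> expR 1 * l * p <= p ^+ 2 ->
  exists r, last_root p l r.
Proof.
move=> p0 elp.
have [/andP[l0 pp]|pl] := boolP (l <= 0 < p).
  have le_g : 0 <= gap p l p^-1.
    rewrite /gap mulVf// subr_ge0 -expR0 ler_expR.
    by rewrite pmulr_rle0 ?invr_gt0.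
  have [|||r _ gr] := @IVT R (gap p l) 0 p^-1 0.
  - by rewrite invr_ge0 ltW.
  - exact: continuous_gap.
  - rewrite ge_min le_max le_g orbT andbT {1}/gap !mul0r expR0 sub0r.
    by rewrite oppr_le0 ler01.
  by exists r; split=> //; left; apply/andP.
have plI : p < 0 \/ 0 < l.
  move: pl; rewrite negb_and -ltNge -leNgt => /orP[|pl]; first by right.
  by left; rewrite lt_neqAle p0.
suff [c [gc cl]] : exists c, 0 <= gap p l c /\
    forall r, c <= r -> 0 < r * p -> r^-1 <= l.
  have [r cr gr] := gap_root_ge plI gc.
  exists r; split=> //; right; apply: cl => //; apply: (@gap_ge0_gt0 _ l).
  by rewrite gr.
(* If [l p > 0], take [c = l^-1], where the gap is [p / l - e]. Otherwise [p < 0 <= l], and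
   [c = p^-1] has gap [1 - exp (l / p)]. *)
have [lp|lp] := ltP 0 (l * p).
  have l0 : l != 0 by apply: contraTN lp => /eqP ->; rewrite mul0r ltxx.
  exists l^-1; split.
    rewrite /gap mulVf// subr_ge0 -(ler_pM2r lp).
    have -> : l^-1 * p * (l * p) = p ^+ 2 by field.
    by rewrite mulrA.
  move=> r lr rp.
  have lr0 : 0 < l * r.
    have p2 : 0 < p ^+ 2 by rewrite exprn_even_gt0.
    rewrite -(pmulr_lgt0 _ p2).
    by have -> : l * r * p ^+ 2 = l * p * (r * p) by [ring]; rewrite mulr_gt0.
  have r0 : r != 0 by apply: contraTN rp => /eqP ->; rewrite mul0r ltxx.
  have lr1 : 0 < l / r.
    have -> : l / r = l * r / r ^+ 2 by field.
    by rewrite divr_gt0// exprn_even_gt0.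
  move: lr; rewrite -(ler_pM2l lr1) divfK//.
  by have -> : l / r / l = r^-1 by [field; rewrite r0].
have pn : p < 0.
  case: plI => // l0; rewrite lt_neqAle p0/=.
  by move: lp; rewrite pmulr_rle0.
have l0 : 0 <= l by move: lp; rewrite nmulr_lle0.
exists p^-1; split.
  by rewrite /gap mulVf// subr_ge0 -expR0 ler_expR mulr_le0_ge0// invr_le0 ltW.
move=> r _; rewrite nmulr_lgt0// => r0; apply: le_trans l0.
by rewrite invr_le0 ltW.
Qed.

(** Converse of [last_root_exists]: [exp x >= e x] at [x = r l] gives [e r l <= r p]; multiply by
    [r p > 0] and cancel [r^2]. *)
Lemma gap_root_bound p l r : gap p l r = 0 ->
  p != 0 /\ expR 1 * l * p <= p ^+ 2.
Proof.
move=> gr; have rp : 0 < r * p by apply: (@gap_ge0_gt0 _ l); rewrite gr.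
have r0 : r != 0 by apply: contraTN rp => /eqP ->; rewrite mul0r ltxx.
split; first by apply: contraTN rp => /eqP ->; rewrite mulr0 ltxx.
have H : r * l * expR 1 <= r * p.
  move: gr => /eqP; rewrite subr_eq0 => /eqP ->.
  have -> : expR (r * l) = expR (r * l - 1) * expR 1.
    by rewrite -expRD subrK.
  rewrite ler_pM2r ?expR_gt0//.
  by have := expR_ge1Dx (r * l - 1); lra.
have r2 : 0 < r ^+ 2 by rewrite exprn_even_gt0.
rewrite -(ler_pM2l r2).
have -> : r ^+ 2 * (expR 1 * l * p) = r * l * expR 1 * (r * p) by ring.
have -> : r ^+ 2 * p ^+ 2 = r * p * (r * p) by ring.
by rewrite ler_pM2r.
Qed.

End LineExponential.

(** * Domain and values of the implicit function *)

Section ImplicitFunction.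
Variables (R : realType) (P Q : {poly R}).
Implicit Types s t r c : R.

Let D := implicit_dom P Q.
Let f := implicit_fun P Q.

Lemma solutionsE s r :
  solutions P Q s r <-> 0 < Q.[s] /\ gap P.[s] (ln Q.[s]) r = 0.
Proof.
by rewrite /solutions/= /Rfun /gap /powR; split=> -[Q0]; rewrite gt_eqF.
Qed.

Lemma implicit_funE s r : 0 < Q.[s] -> last_root P.[s] (ln Q.[s]) r ->
  f s = r.
Proof.
move=> Q0 rr; have [gr _] := rr.
apply: xget_subset1.
  split; first exact/solutionsE.
  by move=> r' /solutionsE[_]; exact: last_root_max.
move=> x y [sx ux] [sy uy]; apply/eqP; rewrite eq_le.
by rewrite (uy x sx) (ux y sy).
Qed.

(** Solvability becomes a set of sign conditions, which propagate along cells. *)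
Lemma implicit_domE s : D s <-> [/\ 0 < Q.[s], P.[s] != 0 &
  expR 1 * ln Q.[s] * P.[s] <= P.[s] ^+ 2].
Proof.
split=> [[r /solutionsE[Q0 /gap_root_bound[]]]//|[Q0 p0 H]].
by have [r [gr _]] := last_root_exists p0 H; exists r; apply/solutionsE.
Qed.

Lemma implicit_fun_last_root s : D s -> last_root P.[s] (ln Q.[s]) (f s).
Proof.
move=> /implicit_domE[Q0 p0 H].
by have [r rr] := last_root_exists p0 H; rewrite (implicit_funE Q0 rr).
Qed.

(** With [implicit_fun_lt], this locates [f s] relative to a fixed number by the sign of the gap
    there, so that extremality passes from [f] to a differentiable function of [s]. *)
Lemma lt_implicit_fun s c : D s -> P.[s] < 0 \/ 0 < ln Q.[s] ->
  0 < gap P.[s] (ln Q.[s]) c -> c < f s.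
Proof.
move=> Ds pl gc; have [r cr gr] := gap_root_ge pl (ltW gc).
apply: (@lt_le_trans _ _ r).
  by rewrite lt_neqAle cr andbT; apply: contraTN gc => /eqP ->; rewrite gr ltxx.
exact: last_root_max (implicit_fun_last_root Ds) gr.
Qed.

Lemma implicit_fun_lt s c : D s -> 0 < c * P.[s] -> c^-1 <= ln Q.[s] ->
  gap P.[s] (ln Q.[s]) c < 0 -> f s < c.
Proof.
move=> Ds cp cl gc; have [gf _] := implicit_fun_last_root Ds.
rewrite ltNge le_eqVlt; apply/negP => /predU1P[cf|cf].
  by move: gc; rewrite cf gf ltxx.
by have := gap_lt0_after cp cl (ltW gc) cf; rewrite gf ltxx.
Qed.

End ImplicitFunction.

(* The derivation rules of the library at type R, with products instead of
   scalings, so that [field] recognizes the values. *)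
Section RealDerivatives.
Variable R : realType.
Implicit Types (f g : R -> R) (s d e : R).

Lemma real_derive_eq f s d e :
  is_derive s 1 f d -> d = e -> is_derive s 1 f e.
Proof. by move=> H <-. Qed.

Lemma real_deriveB f g s d e : is_derive s 1 f d -> is_derive s 1 g e ->
  is_derive s 1 (fun t => f t - g t) (d - e).
Proof. exact: is_deriveB. Qed.

Lemma real_deriveM f g s d e : is_derive s 1 f d -> is_derive s 1 g e ->
  is_derive s 1 (fun t => f t * g t) (f s * e + g s * d).
Proof. exact: is_deriveM. Qed.

Lemma real_deriveZ f (c : R) s d : is_derive s 1 f d ->
  is_derive s 1 (fun t => c * f t) (c * d).
Proof. exact: is_deriveZ. Qed.

Lemma real_deriveV f s d : f s != 0 -> is_derive s 1 f d ->
  is_derive s 1 (fun t => (f t)^-1) (- (f s) ^- 2 * d).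
Proof. exact: is_deriveV. Qed.

Lemma real_derive_ln f s d : 0 < f s -> is_derive s 1 f d ->
  is_derive s 1 (fun t => ln (f t)) (d / f s).
Proof.
move=> f0 fd; rewrite mulrC -[fun t => _]/((@ln R) \o f).
exact: is_derive1_comp (is_derive1_ln f0) fd.
Qed.

Lemma near_eq0_derive0 f s d :
  (\forall t \near s, f t = 0) -> is_derive s 1 f d -> d = 0.
Proof.
move=> f0 fd; have [_ <-] := near_eq_is_derive f0 fd.
exact: derive_cst.
Qed.

Lemma is_derive_div (p q : {poly R}) s : q.[s] != 0 ->
  is_derive s 1 (fun t => p.[t] / q.[t])
    ((p^`() * q - p * q^`()).[s] / (q.[s]) ^+ 2).
Proof.
move=> q0; have qV := real_deriveV q0 (is_derive_poly q s).
apply: (real_derive_eq (real_deriveM (is_derive_poly p s) qV)).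
by rewrite hornerD hornerN !hornerM; field.
Qed.

Lemma is_derive_ln_horner (q : {poly R}) s : 0 < q.[s] ->
  is_derive s 1 (fun t => ln q.[t]) (q^`().[s] / q.[s]).
Proof. by move=> q0; apply: real_derive_ln.  Qed.

End RealDerivatives.

(** * Constancy deduced from derivatives *)

Lemma deriv_eq0_horner (R : realType) (p : {poly R}) :
  p^`() = 0 -> forall s t, p.[s] = p.[t].
Proof.
move=> p'0; have p1 : (size p <= 1)%N.
  apply/leq_sizeP => -[//|j] _; have /eqP := coef_deriv p j.
  by rewrite p'0 coef0 eq_sym mulrn_eq0/= => /eqP.
by move=> s t; rewrite (size1_polyC p1) !hornerC.
Qed.

(** By degrees: if both derivatives were nonzero, the right side would have degree at least that of
    [q], the left side a smaller one. *)
Lemma deriv_eq_mul (R : realType) (p q : {poly R}) (c : R) : c != 0 ->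
  q != 0 -> c *: q^`() = p^`() * q -> p^`() = 0 /\ q^`() = 0.
Proof.
move=> c0 q0 E.
have [q'0|q'0] := eqVneq q^`() 0.
  split=> //; apply/eqP; move: E => /esym/eqP.
  by rewrite q'0 scaler0 mulf_eq0 (negbTE q0) orbF.
have p'0 : p^`() != 0.
  apply: contra_neq q'0 => p'0; move: E; rewrite p'0 mul0r => /eqP.
  by rewrite scaler_eq0 (negbTE c0) => /eqP.
move/(congr1 (size \o val)): E => /=.
rewrite size_scale// size_mul// => E.
have := lt_size_deriv q0; rewrite E ltnNge => /negP; case.
rewrite -subn1 leq_subRL ?leq_add2r ?size_poly_gt0//.
by rewrite addn_gt0 size_poly_gt0 p'0.
Qed.

Lemma same_cell_derive0_cst (R : realType) (F : seq R) (f : R -> R) s :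
  (forall u, same_cell F s u -> is_derive u 1 f 0) ->
  forall t, same_cell F s t -> f t = f s.
Proof.
move=> df.
suff H a b : a < b -> same_cell F a b -> same_cell F s a -> f a = f b.
  move=> t st; have sF : s \notin F by case/same_cellP: st.
  have [lt_st|lt_ts|->//] := ltgtP s t.
    by apply/esym/H => //; exact: same_cell_refl.
  by apply: H => //; rewrite same_cell_sym.
move=> ab abF sa.
have dab u : a <= u <= b -> is_derive u 1 f 0.
  by move=> aub; apply/df/(same_cell_trans sa)/(same_cell_between abF).
have [||c _] := @MVT R f (fun=> 0) a b ab.
- by move=> u; rewrite in_itv/= => /andP[au ub]; apply: dab; rewrite !ltW.
- apply: derivable_within_continuous => u; rewrite in_itv/= => aub.
  by have [] := dab u aub.
by rewrite mul0r => /eqP; rewrite subr_eq0 eq_sym => /eqP.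
Qed.

(** * Local extrema and the critical equation *)

Section LocalExtrema.
Variables (R : realType) (P Q : {poly R}).
Implicit Types s t r c : R.

Let D := implicit_dom P Q.
Let f := implicit_fun P Q.

Lemma is_derive_gap s r : 0 < Q.[s] ->
  is_derive s 1 (fun t => gap P.[t] (ln Q.[t]) r)
    (r * P^`().[s] - r * (Q^`().[s] / Q.[s]) * expR (r * ln Q.[s])).
Proof.
move=> Q0; have lnQ := is_derive_ln_horner Q0.
have H := real_deriveB (real_deriveZ r (is_derive_poly P s))
  (is_derive1_comp (is_derive_expR _) (real_deriveZ r lnQ)).
by apply: (real_derive_eq H); ring.
Qed.

(** With [r] frozen at [f s], the sign of the gap at [t] tells on which side of [r] the value [f t]
    lies, so the gap is extremal at [s]. Maxima and minima are exchanged in the first case, where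
    the gap increases in [r], and kept in the second. *)
Lemma local_extremum_gap_derive0 s r :
  r = f s -> D s -> (\forall t \near s, D t) ->
  (\forall t \near s, ln Q.[t] <= 0 < P.[t]) \/
  ((\forall t \near s, P.[t] < 0 \/ 0 < ln Q.[t]) /\
   (\forall t \near s, 0 < r * P.[t]) /\ r^-1 < ln Q.[s]) ->
  local_extremum D f s ->
  r * P^`().[s] - r * (Q^`().[s] / Q.[s]) * expR (r * ln Q.[s]) = 0.
Proof.
move=> rE Ds nD cases ext; have [Q0 _ _] := (implicit_domE P Q s).1 Ds.
have dg := is_derive_gap r Q0.
have nQ : \forall t \near s, 0 < Q.[t].
  by apply: filterS nD => t /implicit_domE[].
have ndg : \forall t \near s, derivable (fun t => gap P.[t] (ln Q.[t]) r) t 1.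
  by apply: filterS nQ => t /(is_derive_gap r)[].
have gs : gap P.[s] (ln Q.[s]) r = 0.
  by rewrite rE; have [] := implicit_fun_last_root Ds.
have gap_f t : D t -> gap P.[t] (ln Q.[t]) (f t) = 0.
  by move=> /implicit_fun_last_root[].
case: cases => [lp|[pl [rp rl]]].
  have incr t : ln Q.[t] <= 0 < P.[t] -> D t ->
      (f t <= r -> 0 <= gap P.[t] (ln Q.[t]) r) /\
      (r <= f t -> gap P.[t] (ln Q.[t]) r <= 0).
    move=> lpt Dt; rewrite !le_eqVlt -(gap_f t Dt).
    by split=> /predU1P[->|/(gap_incr lpt) ->]; rewrite ?eqxx ?orbT.
  case: ext => -[_ ext].
    apply: near_min_derive0 ndg _ dg; rewrite gs; near=> t.
    have Dt : D t by near: t.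
    apply: (incr t _ Dt).1; first by near: t.
    by rewrite rE; near: t; apply: filterS2 nD ext => t Dt; exact.
  apply: near_max_derive0 ndg _ dg; rewrite gs; near=> t.
  have Dt : D t by near: t.
  apply: (incr t _ Dt).2; first by near: t.
  by rewrite rE; near: t; apply: filterS2 nD ext => t Dt; exact.
have lnQ := is_derive_ln_horner Q0.
(* Strictness at [s], that is, absence of tangency, makes the inequality persist nearby, as
   [implicit_fun_lt] needs. *)
have nrl : \forall t \near s, r^-1 < ln Q.[t].
  have ct : {for s, continuous (fun t => ln Q.[t])}.
    by apply/differentiable_continuous/derivable1_diffP; case: lnQ.
  exact: (cvgr_gt _ ct).
case: ext => -[_ ext].
  apply: near_max_derive0 ndg _ dg; rewrite gs; near=> t.
  have Dt : D t by near: t.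
  rewrite leNgt; apply/negP => g0.
  have : f t <= r by rewrite rE; near: t; apply: filterS2 nD ext => t Dt; exact.
  rewrite leNgt => /negP; apply; apply: lt_implicit_fun => //.
  by near: t.
apply: near_min_derive0 ndg _ dg; rewrite gs; near=> t.
have Dt : D t by near: t.
rewrite leNgt; apply/negP => g0.
have : r <= f t by rewrite rE; near: t; apply: filterS2 nD ext => t Dt; exact.
rewrite leNgt => /negP; apply; apply: implicit_fun_lt => //.
  by near: t.
by apply: ltW; near: t.
Unshelve. all: by end_near. Qed.

(* T vanishes only where the line is tangent to the exponential curve;
   h = M / N is the only possible value of the implicit function at a critical
   point, with derivative dh; A' is where such a point can lie. *)
Let A := [set s | 0 < Q.[s]].
Let lnQ s := ln Q.[s].
Let T s := expR 1 * lnQ s - P.[s].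
Let N := P * Q^`().
Let M := P^`() * Q.
Let A' := A `&` [set s | 0 < (P^`() * Q^`()).[s]]
  `&` [set s | 0 < (P ^+ 2).[s]].
Let U s := lnQ s - N.[s] / M.[s].
Let G s := ln (M.[s] / N.[s] * P.[s]) - M.[s] / N.[s] * lnQ s.
Let dh s := (M^`() * N - M * N^`()).[s] / N.[s] ^+ 2.

Lemma tame_set_horner_gt0 (p : {poly R}) : tame_set [set s | 0 < p.[s]].
Proof. exact/tame_gt0/tame_poly. Qed.

(** The derivative is rational, hence tame; the same pattern serves [T] and [U]. *)
Lemma tame_lnQ : tame A lnQ.
Proof.
apply: (tame_rolle (df := fun s => Q^`().[s] / Q.[s])).
- exact: tame_set_horner_gt0.
- by move=> s; exact: is_derive_ln_horner.
- by apply: tameM; [|apply: tameV]; exact: tame_poly.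
Qed.

Lemma is_derive_T s : A s ->
  is_derive s 1 T ((expR 1 *: Q^`() - P^`() * Q).[s] / Q.[s]).
Proof.
move=> As; have Q0 : Q.[s] != 0 by rewrite gt_eqF.
have H := real_deriveB (real_deriveZ (expR 1) (is_derive_ln_horner As))
  (is_derive_poly P s).
apply: (real_derive_eq H).
by rewrite hornerD hornerN !(hornerM, hornerZ); field.
Qed.

Lemma tame_T : tame A T.
Proof.
apply: (tame_rolle (df := fun s => (expR 1 *: Q^`() - P^`() * Q).[s] / Q.[s])).
- exact: tame_set_horner_gt0.
- exact: is_derive_T.
- by apply: tameM; [|apply: tameV]; exact: tame_poly.
Qed.

Lemma tame_A' : tame_set A'.
Proof. by do 2?apply: tame_setI; exact: tame_set_horner_gt0. Qed.

(** Since [h P = P' Q' Q / Q'^2], positivity of [P' Q'] yields [h P > 0], as the logarithm in [G]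
    requires. Nonvanishing of [P] is coded as [0 < P^2] so that [tame_set_horner_gt0] applies. *)
Lemma critical_setP s : A' s -> [/\ 0 < Q.[s], P.[s] != 0, P^`().[s] != 0,
  Q^`().[s] != 0 & 0 < M.[s] / N.[s] * P.[s]].
Proof.
move=> [[/= Q0 PQ] /= P2]; move: PQ P2; rewrite hornerM horner_exp => PQ P2.
have P0 : P.[s] != 0 by apply: contraTN P2 => /eqP ->; rewrite expr0n ltxx.
have P'0 : P^`().[s] != 0 by apply: contraTN PQ => /eqP ->; rewrite mul0r ltxx.
have Q'0 : Q^`().[s] != 0 by apply: contraTN PQ => /eqP ->; rewrite mulr0 ltxx.
split=> //; rewrite !hornerM.
have -> : P^`().[s] * Q.[s] / (P.[s] * Q^`().[s]) * P.[s] =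
  P^`().[s] * Q^`().[s] * Q.[s] / (Q^`().[s] ^+ 2) by field; rewrite P0 Q'0.
by apply: divr_gt0; [exact: mulr_gt0|rewrite exprn_even_gt0].
Qed.

Lemma tame_U : tame A' U.
Proof.
pose W := N^`() * M - N * M^`().
apply: (tame_rolle (df := fun s =>
  (Q^`() * M ^+ 2 - W * Q).[s] / (Q * M ^+ 2).[s])).
1: exact: tame_A'.
2: by apply: tameM; [|apply: tameV]; exact: tame_poly.
move=> s /critical_setP[Q0 P0 P'0 Q'0 _].
have Qn0 : Q.[s] != 0 by rewrite gt_eqF.
have M0 : M.[s] != 0 by rewrite hornerM mulf_neq0.
have H := real_deriveB (is_derive_ln_horner Q0) (is_derive_div N M0).
apply: (real_derive_eq H); rewrite -/W !(hornerD, hornerN, hornerM, horner_exp).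
by field; rewrite Qn0 P'0.
Qed.

Lemma is_derive_h s : A' s -> is_derive s 1 (fun t => M.[t] / N.[t]) (dh s).
Proof.
move=> /critical_setP[Q0 P0 P'0 Q'0 _].
by apply: is_derive_div; rewrite hornerM mulf_neq0.
Qed.

(** The terms [P' / P] and [h Q' / Q] cancel by the definition of [h], leaving [h' (1 / h - l)]. *)
Lemma is_derive_G s : A' s -> is_derive s 1 G (- (dh s * U s)).
Proof.
move=> As; have [Q0 P0 P'0 Q'0 hP] := critical_setP As.
have Qn0 : Q.[s] != 0 by rewrite gt_eqF.
have H1 := is_derive_h As.
have H2 := real_deriveM H1 (is_derive_poly P s).
have H3 := @real_derive_ln _ (fun t => M.[t] / N.[t] * P.[t]) _ _ hP H2.
have H4 := real_deriveM H1 (is_derive_ln_horner Q0).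
apply: (real_derive_eq (real_deriveB H3 H4)).
rewrite /U /lnQ.
have -> : M.[s] = P^`().[s] * Q.[s] by rewrite hornerM.
have -> : N.[s] = P.[s] * Q^`().[s] by rewrite hornerM.
by field; rewrite Qn0 P0 P'0 Q'0.
Qed.

Lemma tame_G : tame A' G.
Proof.
apply: (tame_rolle (df := fun s => - (dh s * U s))).
- exact: tame_A'.
- exact: is_derive_G.
- apply: (@eq_tame _ _ (fun s => -1 * (dh s * U s))).
    by move=> s _; rewrite mulN1r.
  apply: tameM; first exact: tame_cst.
  apply: tameM tame_U; rewrite /dh.
  apply: (@eq_tame _ _ (fun s =>
      (M^`() * N - M * N^`()).[s] / (N ^+ 2).[s])).
    by move=> s _; rewrite horner_exp.
  by apply: tameM; [|apply: tameV]; exact: tame_poly.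
Qed.

Lemma implicit_fun_eq s t : P.[s] = P.[t] -> Q.[s] = Q.[t] ->
  D s -> D t /\ f t = f s.
Proof.
move=> Pst Qst Ds.
have E : solutions P Q t = solutions P Q s.
  by rewrite /solutions /Rfun Pst Qst.
by rewrite /D /f /implicit_dom /implicit_fun /= E; split.
Qed.

Lemma local_extremum_locally_cst : exists F : seq R,
  forall s, s \notin F -> local_extremum D f s ->
  forall t, same_cell F s t -> D t /\ f t = f s.
Proof.
have [F1 HA] := tame_set_horner_gt0 Q.
have [F2 HP] := tame_poly setT P.
have [F3 HL] := tame_lnQ.
have [F4 HT] := tame_T.
have [F5 HA'] := tame_A'.
have [F6 HU] := tame_U.
have [F7 HG] := tame_G.
have [F8 HP'] := finite_roots P^`().
have [F9 HQ'] := finite_roots Q^`().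
have [F10 HTW] := finite_roots (expR 1 *: Q^`() - P^`() * Q).
(* The first seven lists fix, on each cell, the signs of [Q], [P], [lnQ], [T], membership in [A'],
   and the signs of [U] and [G]; the last three absorb the roots of nonzero polynomials. *)
pose F := F1 ++ F2 ++ F3 ++ F4 ++ F5 ++ F6 ++ F7 ++ F8 ++ F9 ++ F10.
exists F => s sF ext; set r := f s.
have Ds : D s by case: ext => -[].
have [Q0 P0 _] := (implicit_domE P Q s).1 Ds.
have [cst t _|ncst] := pselect (P^`() = 0 /\ Q^`() = 0).
  by have [P'0 Q'0] := cst; apply: implicit_fun_eq => //;
    exact: deriv_eq0_horner.
have rE : last_root P.[s] (ln Q.[s]) r := implicit_fun_last_root Ds.
have gr : gap P.[s] (ln Q.[s]) r = 0 by case: rE.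
have rP : 0 < r * P.[s] by apply: (@gap_ge0_gt0 _ _ (ln Q.[s])); rewrite gr.
have r0 : r != 0 by apply: contraTN rP => /eqP ->; rewrite mul0r ltxx.
have cellP t : same_cell F s t -> [/\ same_cell F1 s t, same_cell F2 s t,
    same_cell F3 s t, same_cell F4 s t &
    [/\ same_cell F5 s t, same_cell F6 s t, same_cell F7 s t &
    [/\ s \notin F8, s \notin F9 & s \notin F10]]].
  rewrite !same_cell_cat => /and5P[-> -> -> -> /and5P[-> -> ->]].
  by move=> /same_cellP[-> _ _] /andP[/same_cellP[-> _ _] /same_cellP[-> _ _]].
have sFs := same_cell_refl sF.
have [_ _ _ _ [_ _ _ [nF8 nF9 nF10]]] := cellP _ sFs.
have cQ t : same_cell F s t -> 0 < Q.[t].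
  by move=> /cellP[st _ _ _ _]; exact: HA st Q0.
have cP t : same_cell F s t -> Num.sg P.[t] = Num.sg P.[s].
  by move=> /cellP[_ st _ _ _]; rewrite (HP s t).
have cL t : same_cell F s t -> Num.sg (ln Q.[t]) = Num.sg (ln Q.[s]).
  by move=> st; have [_ _ st3 _ _] := cellP _ st;
    rewrite -[LHS](HL s t)//; exact: cQ.
have cT t : same_cell F s t -> Num.sg (T t) = Num.sg (T s).
  by move=> st; have [_ _ _ st4 _] := cellP _ st;
    rewrite -(HT s t)//; exact: cQ.
have crP t : same_cell F s t -> 0 < r * P.[t].
  by move=> st; rewrite -sgr_gt0 sgrM cP// -sgrM sgr_gt0.
(* The remaining domain condition is the sign condition [T P <= 0]. *)
have domE t : (expR 1 * ln Q.[t] * P.[t] <= P.[t] ^+ 2) =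
    (Num.sg (T t * P.[t]) <= 0).
  have -> : T t * P.[t] = expR 1 * ln Q.[t] * P.[t] - P.[t] ^+ 2.
    by rewrite /T /lnQ; ring.
  by rewrite sgr_le0 subr_le0.
have cD t : same_cell F s t -> D t.
  move=> st; apply/implicit_domE; split; first exact: cQ.
    by rewrite -sgr_eq0 cP// sgr_eq0.
  rewrite domE sgrM cT// cP// -sgrM -domE.
  by have [] := (implicit_domE P Q s).1 Ds.
have near_s := same_cell_near sF.
(* Otherwise [T] vanishes around [s], so [e Q' = P' Q] there and then as polynomials, which makes
   [P] and [Q] constant. *)
have T0 : T s != 0.
  apply/eqP => Ts; apply: ncst.
  have nT : \forall t \near s, T t = 0.
    by apply: filterS near_s => t /cT/eqP; rewrite Ts sgr0 sgr_eq0 => /eqP.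
  have /eqP := near_eq0_derive0 nT (is_derive_T Q0).
  rewrite mulf_eq0 invr_eq0 (gt_eqF Q0) orbF => /eqP /HTW /(_ nF10) /eqP.
  rewrite subr_eq0 => /eqP /deriv_eq_mul; apply.
    by rewrite gt_eqF ?expR_gt0.
  by apply: contraTneq Q0 => ->; rewrite horner0 ltxx.
(* Equality would give [exp (r l) = e = r P], that is, [T s = 0]. *)
have rl : r^-1 != ln Q.[s].
  apply: contra_neq T0 => rl; move/eqP: gr; rewrite /gap -rl mulfV// subr_eq0.
  by move=> /eqP gr; rewrite /T /lnQ -gr -rl mulrAC mulfV// mul1r subrr.
have caseI : ~~ (ln Q.[s] <= 0 < P.[s]) -> r^-1 < ln Q.[s].
  move=> nlp; rewrite lt_neqAle rl/=.
  by have [_ []] := rE => // lp; rewrite lp in nlp.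
have crit : r * P^`().[s] - r * (Q^`().[s] / Q.[s]) * expR (r * ln Q.[s]) = 0.
  apply: local_extremum_gap_derive0 ext => //.
    exact: filterS near_s.
  have [lp|nlp] := boolP (ln Q.[s] <= 0 < P.[s]); [left|right].
    apply: filterS near_s => t st.
    by rewrite -sgr_le0 cL// -sgr_gt0 cP// sgr_le0 sgr_gt0.
  split; last by split; [exact: filterS near_s|exact: caseI].
  apply: filterS near_s => t st.
  rewrite -sgr_lt0 cP// -[0 < _]sgr_gt0 cL// sgr_lt0 sgr_gt0.
  move: nlp; rewrite negb_and -ltNge -leNgt => /orP[|]; first by right.
  by rewrite le_eqVlt (negbTE P0); left.
have Qn0 : Q.[s] != 0 by rewrite gt_eqF.
(* Substituting [exp (r l) = r P] removes the exponential from the critical equation. *)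
have {}crit : M.[s] = r * N.[s].
  have rPE : expR (r * ln Q.[s]) = r * P.[s].
    by apply/eqP; rewrite eq_sym -subr_eq0; apply/eqP.
  move: crit; rewrite rPE => crit; apply: (mulfI r0); apply/eqP.
  rewrite -subr_eq0 /M /N !hornerM -[X in _ == X](mulr0 Q.[s]) -crit.
  by apply/eqP; field.
have Q'0 : Q^`().[s] != 0.
  apply/eqP => Q'0; apply: ncst; split; last exact: HQ' nF9.
  apply: HP' nF8; apply/eqP; move/eqP: crit.
  by rewrite /M /N !hornerM Q'0 !mulr0 mulf_eq0 (negbTE Qn0) orbF.
have N0 : N.[s] != 0 by rewrite hornerM mulf_neq0.
have hs : M.[s] / N.[s] = r by rewrite crit mulfK.
have A's : A' s.
  split; last by rewrite /= horner_exp exprn_even_gt0.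
  split=> //=; rewrite hornerM.
  have -> : P^`().[s] * Q^`().[s] = r * P.[s] * Q^`().[s] ^+ 2 / Q.[s].
    apply: (mulIf Qn0); rewrite divfK// mulrAC expr2 mulrA; congr (_ * _).
    by move: crit; rewrite /M /N !hornerM mulrA.
  by apply: divr_gt0 => //; apply: mulr_gt0 => //; rewrite exprn_even_gt0.
have cA' t : same_cell F s t -> A' t.
  by move=> /cellP[_ _ _ _ [st _ _ _]]; exact: HA' st A's.
have cU t : same_cell F s t -> Num.sg (U t) = Num.sg (U s).
  move=> st; have [_ _ _ _ [_ st' _ _]] := cellP _ st.
  by rewrite -(HU s t)//; exact: cA'.
have cG t : same_cell F s t -> Num.sg (G t) = Num.sg (G s).
  move=> st; have [_ _ _ _ [_ _ st' _]] := cellP _ st.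
  by rewrite -(HG s t)//; exact: cA'.
have hVs : N.[s] / M.[s] = r^-1 by rewrite -hs invf_div.
have Us : U s = ln Q.[s] - r^-1 by rewrite /U hVs.
have U0 t : same_cell F s t -> U t != 0.
  by move=> st; rewrite -sgr_eq0 cU// sgr_eq0 Us subr_eq0 eq_sym.
(* At [s], [h = r] and [exp (r l) = r P], so [G] vanishes there, and its constant sign spreads this
   to the cell. *)
have G0 t : same_cell F s t -> G t = 0.
  move=> /cG/eqP; rewrite [G s](_ : _ = 0) ?sgr0 ?sgr_eq0 => [/eqP//|].
  rewrite /G hs /lnQ; move/eqP: gr; rewrite subr_eq0 => /eqP ->.
  by rewrite expRK subrr.
(* The derivative [- dh U] of [G] vanishes on the cell, while [U] does not. *)
have dh0 t : same_cell F s t -> dh t = 0.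
  move=> st; have nG : \forall u \near t, G u = 0.
    have tF : t \notin F by case/same_cellP: st.
    by apply: filterS (same_cell_near tF) => u /(same_cell_trans st)/G0.
  have /eqP := near_eq0_derive0 nG (is_derive_G (cA' _ st)).
  by rewrite oppr_eq0 mulf_eq0 (negbTE (U0 _ st)) orbF => /eqP.
have hcst t : same_cell F s t -> M.[t] / N.[t] = r.
  move=> st; rewrite -hs.
  apply: (@same_cell_derive0_cst _ F (fun t => M.[t] / N.[t])) st => u su.
  by rewrite -(dh0 _ su); apply/is_derive_h/cA'.
move=> t st; split; first exact: cD.
(* Now [G t = 0] with [h = r] makes [r] a zero at [t], and the constant signs of [lnQ], [P] and [U]
   keep it the last one. *)
apply: implicit_funE; first exact: cQ.
split.
  have := G0 _ st; rewrite /G hcst// => /eqP.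
  rewrite subr_eq0 => /eqP lnE; rewrite /gap -/(lnQ t) -lnE lnK ?subrr//.
  exact: crP.
have [lp|nlp] := boolP (ln Q.[s] <= 0 < P.[s]); [left|right].
  by rewrite -sgr_le0 cL// -sgr_gt0 cP// sgr_le0 sgr_gt0.
rewrite -(hcst _ st) invf_div -subr_ge0 -/(lnQ t) -/(U t) -sgr_ge0 cU//.
by rewrite sgr_ge0 Us subr_ge0 ltW// caseI.
Qed.

End LocalExtrema.

(** * Counting plateaus *)

Lemma plateau_eq (R : realType) (D : set R) (f : R -> R) s t :
  (forall u, Num.min s t <= u <= Num.max s t -> D u /\ f u = f s) ->
  plateau D f s = plateau D f t.
Proof.
move=> H.
suff sub a b :
    (forall u, Num.min a b <= u <= Num.max a b -> D u /\ f u = f a) ->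
    plateau D f a `<=` plateau D f b.
  apply/seteqP; split; apply: sub => // u; rewrite minC maxC => /H[Du ->].
  by split=> //; have [|_ ->] := H t; rewrite // ge_min le_max lexx !orbT.
move=> {}H x xa u uu; have [_ fb] : D b /\ f b = f a.
  by apply: H; rewrite ge_min le_max lexx !orbT.
rewrite fb.
(* A point between [b] and [x] but not between [a] and [b] lies between [a] and [x]. *)
have [/H//|ab] := boolP (Num.min a b <= u <= Num.max a b).
apply: xa; move: ab uu.
case: (leP a b) => ?; case: (leP a x) => ?; case: (leP b x) => ?;
  rewrite negb_and -!ltNge => /orP[?|?] /andP[? ?]; apply/andP; split; lra.
Qed.

(** Each plateau is that of a point of [F] or of the representative of a cell. *)
Lemma finitely_many_plateaus (R : realType) (D E : set R) (f : R -> R)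
    (F : seq R) :
  (forall s, s \notin F -> E s ->
     forall t, same_cell F s t -> D t /\ f t = f s) ->
  finite_set [set plateau D f s | s in E].
Proof.
move=> H.
(* The default 0 arises only for labels without a point of [E]; it merely enlarges the finite set
   that contains all plateaus. *)
pose rep v := xget 0 [set s | [/\ s \notin F, E s & cell_index F s = v]].
apply: (@sub_finite_set _ _ (plateau D f @` [set` F] `|`
    [set plateau D f (rep v) | v in [set: (size F).-tuple bool]])); last first.
  by rewrite finite_setU; split; apply: finite_image; [exact: finite_seq|].
move=> _ [s Es <-]; have [sF|sF] := boolP (s \in F); first by left; exists s.
right; exists (cell_index F s) => //; apply/esym.
have [rF Er /eqP] : [/\ rep (cell_index F s) \notin F,
    E (rep (cell_index F s)) &
    cell_index F (rep (cell_index F s)) = cell_index F s].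
  apply: (@xgetPex _ 0 [set t | [/\ t \notin F, E t & cell_index F t = _]]).
  by exists s.
rewrite cell_indexP// => rs; rewrite same_cell_sym in rs.
apply: plateau_eq => u; set t := rep _ in rs *.
case: (leP s t) => _ su; apply: H => //.
  exact: same_cell_between rs su.
apply: (same_cell_trans rs); apply: same_cell_between su.
by rewrite same_cell_sym.
Qed.

Theorem corollary5p10 (R : realType) (P Q : {poly R}) :
  finitely_many_local_extrema (implicit_dom P Q) (implicit_fun P Q).
Proof.
have [F HF] := local_extremum_locally_cst P Q.
exact: finitely_many_plateaus HF.
Qed.
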